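(* Let $A\in\mathbb{R}^{d\times p}$, $b\in\mathbb{R}^d$, $J\in\Gamma_0(\mathbb{R}^p)$ with $\mathcal S\neq\emptyset$ and $\mathcal Z\neq\emptyset$, let $\delta\ge 0$ and let $b^\delta\in\mathbb{R}^d$ satisfy $\|b^\delta-b\|\le\delta$. Assume: (A1) $\Sigma\in\mathbb{R}^{p\times p}$ and $\Gamma\in\mathbb{R}^{d\times d}$ are diagonal positive definite matrices with $\alpha:=1-\|\Gamma^{1/2}A\Sigma^{1/2}\|^2>0$. (A2) $m\ge 1$ is an integer and $\epsilon_k\in\{1,\dots,m\}$ for every $k\in\mathbb{N}$. (A3) $T_1,\dots,T_m:\mathbb{R}^p\to\mathbb{R}^p$ are operators such that, for every $i\in\{1,\dots,m\}$: (a) $\operatorname{Fix}T_i\supseteq\mathcal S_\delta$; (b) there is $e_i\ge 0$ such that for all $x\in\mathbb{R}^p$ and all $\bar x\in\mathcal S$, $\|T_ix-\bar x\|_{\Sigma^{-1}}^2\le\|x-\bar x\|_{\Sigma^{-1}}^2+e_i\delta^2$. Put $e:=\max_{1\le i\le m}e_i$. Let $p^0=\bar p^0\in\mathbb{R}^p$ and $u^0\in\mathbb{R}^d$, set $x^0:=p^0$, and let the sequences be generated by the following primal-dual iteration, for $k=0,1,2,\dots$: $$\begin{aligned}u^{k+1}&=u^k+\Gamma(A\bar p^k-b^\delta),\\ x^{k+1}&=\operatorname{prox}^{\Sigma}_J(p^k-\Sigma A^*u^{k+1}),\\ p^{k+1}&=T_{\epsilon_{k+1}}x^{k+1},\\ \bar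 p^{k+1}&=p^{k+1}+x^{k+1}-p^k.\end{aligned}$$ Let $z^k:=(x^k,u^k)$ and, for $N\ge1$, $(X^N,U^N):=\frac1N\sum_{k=1}^N z^k$. Then, for every $z=(x,u)\in\mathcal Z$ and every integer $N\ge 1$, $$\mathcal L(X^N,u)-\mathcal L(x,U^N)\le \frac{V(z^0-z)}{N}+\frac{2N\|\Gamma^{1/2}\|^2\delta^2}{\alpha}+\delta\|\Gamma^{1/2}\|\left(\frac{2V(z^0-z)}{\alpha}\right)^{1/2}+\delta\|\Gamma^{1/2}\|\left(\frac{Ne\delta^2}{\alpha}\right)^{1/2}+\frac{e\delta^2}{2}$$ and $$\begin{aligned}\|AX^N-b\|^2\le{}&\frac{16N\|\Gamma\|\|\Gamma^{-1}\|\delta^2}{\alpha^2}+8\delta\|\Gamma^{-1}\|\left(\frac{2\|\Gamma\|V(z^0-z)}{\alpha^3}\right)^{1/2}+8\delta^2\|\Gamma^{-1}\|\left(\frac{\|\Gamma\|eN}{\alpha^3}\right)^{1/2}\\&+\frac{8\|\Gamma^{-1}\|V(z^0-z)}{N\alpha}+2\delta^2+\frac{4\|\Gamma^{-1}\|e\delta^2}{\alpha}.\end{aligned}$$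
   Context: $\Gamma_0(\mathbb{R}^p)$ is the set of proper, convex, lower semicontinuous functions $\mathbb{R}^p\to(-\infty,+\infty]$. $\langle\cdot\mid\cdot\rangle$ and $\|\cdot\|$ are the Euclidean inner product and norm; for matrices $\|\cdot\|$ is the operator norm and $A^*$ is the adjoint (transpose). For a positive definite matrix $M$, $\|x\|_M^2:=\langle x\mid Mx\rangle$. $\operatorname{Fix}T=\{x: Tx=x\}$. The problem is $\min_{x\in\mathbb{R}^p}J(x)$ subject to $Ax=b$; $\mathcal S$ is its set of minimizers. $\mathcal S_\delta$ is the (possibly empty) set of minimizers of $J(x)$ subject to $Ax=b^\delta$. The Lagrangian is $\mathcal L(x,u):=J(x)+\langle u\mid Ax-b\rangle$ (with the exact datum $b$), and its set of saddle points is $$\mathcal Z=\{(x,u)\in\mathbb{R}^p\times\mathbb{R}^d:\ \mathcal L(x,v)\le\mathcal L(x,u)\le\mathcal L(y,u)\ \ \forall (y,v)\in\mathbb{R}^p\times\mathbb{R}^d\}=\{(x,u): 0\in\partial J(x)+A^*u,\ Ax=b\}.$$ $\operatorname{prox}^{\Sigma}_J:=(\mathrm{Id}+\Sigma\,\partial J)^{-1}$, where $\partial J$ is the convex subdifferential. For $z=(x,u)\in\mathbb{R}^p\times\mathbb{R}^d$, $V(z):=\frac12\|x\|_{\Sigma^{-1}}^2+\frac12\|u\|_{\Gamma^{-1}}^2$. *)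

(* Defs.v *)
From HB Require Import structures.
From mathcomp Require Import all_boot all_order all_algebra.
From mathcomp Require Import all_classical all_reals all_analysis.

Set Implicit Arguments.
Unset Strict Implicit.
Unset Printing Implicit Defensive.

Import Order.TTheory GRing.Theory Num.Theory.
Import numFieldNormedType.Exports.

Local Open Scope classical_set_scope.
Local Open Scope ring_scope.

Section Euclidean.
Context {R : realType}.

Definition dot {n : nat} (x y : 'cV[R]_n) : R := \sum_(i < n) x i 0 * y i 0.

(* The library norm on matrices is the max norm, hence a separate notion. *)
Definition enorm {n : nat} (x : 'cV[R]_n) : R := Num.sqrt (dot x x).

(* The squared norm <x | M x>. *)
Definition wnormsq {n : nat} (M : 'M[R]_n) (x : 'cV[R]_n) : R :=
  dot x (M *m x).

(* Operator norm with respect to the Euclidean norms. *)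
Definition opnorm {m n : nat} (M : 'M[R]_(m, n)) : R :=
  sup [set enorm (M *m x) | x in [set x : 'cV[R]_n | enorm x <= 1]].

Definition posdef {n : nat} (M : 'M[R]_n) : Prop :=
  M^T = M /\ forall x : 'cV[R]_n, x != 0 -> 0 < dot x (M *m x).

Definition possemidef {n : nat} (M : 'M[R]_n) : Prop :=
  M^T = M /\ forall x : 'cV[R]_n, 0 <= dot x (M *m x).

(* M^(1/2): the positive semidefinite square root of M, which exists and is
   unique for M positive semidefinite; the default 0 is only used otherwise. *)
Definition mxsqrt {n : nat} (M : 'M[R]_n) : 'M[R]_n :=
  xget 0 [set S | possemidef S /\ S *m S = M].

End Euclidean.

Section Convex.
Context {R : realType} {p : nat}.
Implicit Types (J : 'cV[R]_p -> \bar R) (x y : 'cV[R]_p).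

Definition proper J : Prop :=
  (forall x, J x != -oo%E) /\ exists x, (J x < +oo)%E.

Definition econvex J : Prop :=
  forall x y (t : R), 0 < t < 1 ->
    (J (t *: x + (1 - t) *: y)%R <= t%:E * J x + (1 - t)%:E * J y)%E.

Definition Gamma0 J : Prop :=
  [/\ proper J, econvex J & lower_semicontinuous J].

Definition subdiff J x : set 'cV[R]_p :=
  [set g | forall y, (J x + (dot g (y - x))%:E <= J y)%E].

(* The set-valued operator (Id + Sigma dJ)^-1; for J in Gamma_0 and Sigma
   positive definite its values are singletons, and "x = prox v" is rendered
   by "prox v x". *)
Definition prox (Sigma : 'M[R]_p) J (v : 'cV[R]_p) : set 'cV[R]_p :=
  [set x | exists2 g, subdiff J x g & v = x + Sigma *m g].

Definition Fix (T : 'cV[R]_p -> 'cV[R]_p) : set 'cV[R]_p := [set x | T x = x].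

End Convex.

Section LinearlyConstrained.
Context {R : realType} {p d : nat}.
Variables (J : 'cV[R]_p -> \bar R) (A : 'M[R]_(d, p)) (b : 'cV[R]_d).

(* A minimizer lies in the domain of J: when J = +oo on the whole feasible set
   there is no minimizer. *)
Definition minimizers : set 'cV[R]_p :=
  [set x | [/\ A *m x = b, (J x < +oo)%E &
               forall y, A *m y = b -> (J x <= J y)%E]].

Definition lagrangian (x : 'cV[R]_p) (u : 'cV[R]_d) : \bar R :=
  (J x + (dot u (A *m x - b))%:E)%E.

Definition saddle_points : set ('cV[R]_p * 'cV[R]_d) :=
  [set z | forall (y : 'cV[R]_p) (v : 'cV[R]_d),
     (lagrangian z.1 v <= lagrangian z.1 z.2)%E /\
     (lagrangian z.1 z.2 <= lagrangian y z.2)%E].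

End LinearlyConstrained.

Section PrimalDual.
Context {R : realType} {p d : nat}.
Variables (Sigma : 'M[R]_p) (Gamma : 'M[R]_d).

Definition Vfun (z : 'cV[R]_p * 'cV[R]_d) : R :=
  2^-1 * wnormsq (invmx Sigma) z.1 + 2^-1 * wnormsq (invmx Gamma) z.2.

Definition alpha (A : 'M[R]_(d, p)) : R :=
  1 - opnorm (mxsqrt Gamma *m A *m mxsqrt Sigma) ^+ 2.

End PrimalDual.

Definition ergodic {R : realType} {p d : nat}
    (z : nat -> 'cV[R]_p * 'cV[R]_d) (N : nat) : 'cV[R]_p * 'cV[R]_d :=
  N%:R^-1 *: \sum_(1 <= k < N.+1) z k.

(* Main.v *)
(* In the coordinates y_k = Sigma^(-1/2) (p^k - x), v_k = Gamma^(-1/2) (u^k - u),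
   w_k = Gamma^(1/2) A (x^k - p^(k-1)) around a saddle point (x, u), one
   iteration bounds the Lagrangian gap plus the decrease of
   Phi_k = |y_k|^2 / 2 + |v_k + w_k|^2 / 2 by the noise terms
   delta |Gamma^(1/2)| |v_(k+1)| + e delta^2 / 2.  Here the residual is
   Gamma^(1/2) (A x^(k+1) - b^delta) = (v_(k+1) - v_k - w_k) + w_(k+1), and
   |w_(k+1)|^2 <= (1 - alpha) |Sigma^(-1/2) (x^(k+1) - p^k)|^2, so alpha / 2
   times its square is absorbed on the left; the same argument controls
   alpha |v_(k+1)|^2 / 2.  The latter bounds the |v_k| by induction, the
   telescoped sum then bounds the sums of gaps and of squared residuals, and
   both estimates follow from Jensen's inequality. *)

Require Import Defs.
From HB Require Import structures.
From mathcomp Require Import all_boot all_order all_algebra.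
From mathcomp Require Import all_classical all_reals all_analysis.
From mathcomp Require Import ring lra.

Set Implicit Arguments.
Unset Strict Implicit.
Unset Printing Implicit Defensive.

Import Order.TTheory GRing.Theory Num.Theory.
Import numFieldNormedType.Exports.

Local Open Scope classical_set_scope.
Local Open Scope ring_scope.

(** * Euclidean inner product, Cauchy-Schwarz and the operator norm *)

Section DotTheory.
Context {R : realType}.

Lemma dotE n (x y : 'cV[R]_n) : dot x y = (x^T *m y) 0 0.
Proof. by rewrite mxE; apply: eq_bigr => i _; rewrite mxE. Qed.

Lemma dotC n (x y : 'cV[R]_n) : dot x y = dot y x.
Proof. by apply: eq_bigr => i _; rewrite mulrC. Qed.

Lemma dotDl n (x y z : 'cV[R]_n) : dot (x + y) z = dot x z + dot y z.
Proof. by rewrite !dotE linearD mulmxDl mxE. Qed.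

Lemma dotDr n (x y z : 'cV[R]_n) : dot z (x + y) = dot z x + dot z y.
Proof. by rewrite !(dotC z) dotDl. Qed.

Lemma dotZl n (c : R) (x y : 'cV[R]_n) : dot (c *: x) y = c * dot x y.
Proof. by rewrite !dotE linearZ -scalemxAl mxE. Qed.

Lemma dotZr n (c : R) (x y : 'cV[R]_n) : dot x (c *: y) = c * dot x y.
Proof. by rewrite !(dotC x) dotZl. Qed.

Lemma dotNl n (x y : 'cV[R]_n) : dot (- x) y = - dot x y.
Proof. by rewrite -scaleN1r dotZl mulN1r. Qed.

Lemma dotNr n (x y : 'cV[R]_n) : dot x (- y) = - dot x y.
Proof. by rewrite !(dotC x) dotNl. Qed.

Definition dotlin := (dotDl, dotDr, dotNl, dotNr, dotZl, dotZr).

Lemma dot0r n (x : 'cV[R]_n) : dot x 0 = 0.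
Proof. by rewrite -(scale0r 0) dotZr mul0r. Qed.

Lemma dot_sumr n (I : Type) (s : seq I) (P : pred I) (F : I -> 'cV[R]_n)
    (x : 'cV[R]_n) :
  dot x (\sum_(i <- s | P i) F i) = \sum_(i <- s | P i) dot x (F i).
Proof.
apply: (big_morph (dot x)); [by move=> ? ?; rewrite dotDr | exact: dot0r].
Qed.

Lemma dot_mulmxr n m (M : 'M[R]_(m, n)) (x : 'cV[R]_m) (y : 'cV[R]_n) :
  dot x (M *m y) = dot (M^T *m x) y.
Proof. by rewrite !dotE trmx_mul trmxK mulmxA. Qed.

Lemma dotxx_ge0 n (x : 'cV[R]_n) : 0 <= dot x x.
Proof. by apply: sumr_ge0 => i _; rewrite -expr2 sqr_ge0. Qed.

Lemma dotxx_eq0 n (x : 'cV[R]_n) : dot x x = 0 -> x = 0.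
Proof.
move=> /eqP; rewrite psumr_eq0 => [/allP h|i _]; last by rewrite -expr2 sqr_ge0.
apply/colP => i; have := h i (mem_index_enum i).
by rewrite mulf_eq0 orbb mxE => /eqP.
Qed.

Lemma enormE n (x : 'cV[R]_n) : enorm x ^+ 2 = dot x x.
Proof. by rewrite sqr_sqrtr ?dotxx_ge0. Qed.

Lemma enorm_ge0 n (x : 'cV[R]_n) : 0 <= enorm x.
Proof. exact: sqrtr_ge0. Qed.

Lemma enormZ n (c : R) (x : 'cV[R]_n) : enorm (c *: x) = `|c| * enorm x.
Proof.
by rewrite /enorm dotZl dotZr mulrA -expr2 sqrtrM ?sqr_ge0 // sqrtr_sqr.
Qed.

Lemma enorm0_eq0 n (x : 'cV[R]_n) : enorm x = 0 -> x = 0.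
Proof. by move=> h; apply: dotxx_eq0; rewrite -enormE h expr0n. Qed.

Lemma cauchy_schwarz_sq n (x y : 'cV[R]_n) :
  dot x y ^+ 2 <= dot x x * dot y y.
Proof.
have [y0|yN0] := eqVneq (dot y y) 0.
  by rewrite (dotxx_eq0 y0) !dot0r expr0n /= mulr0.
have yy : 0 < dot y y by rewrite lt_neqAle eq_sym yN0 dotxx_ge0.
have := dotxx_ge0 (dot y y *: x - dot x y *: y).
rewrite !dotlin (dotC y x) => h.
rewrite -(ler_pM2l yy) -subr_ge0.
by apply: le_trans h _; rewrite le_eqVlt; apply/orP; left; apply/eqP; ring.
Qed.

Lemma cauchy_schwarz n (x y : 'cV[R]_n) : dot x y <= enorm x * enorm y.
Proof.
apply: le_trans (ler_norm _) _.
rewrite -(@ler_pXn2r _ 2) ?nnegrE ?mulr_ge0 ?enorm_ge0 // exprMn !enormE.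
by rewrite real_normK ?num_real// cauchy_schwarz_sq.
Qed.

(** The constant is the Frobenius norm. Such a bound makes the supremum in [opnorm] a genuine one
    rather than the default value of [sup]. *)
Lemma enorm_mulmx_bounded m n (M : 'M[R]_(m, n)) :
  exists C : R, forall x : 'cV[R]_n, enorm (M *m x) <= C * enorm x.
Proof.
exists (Num.sqrt (\sum_(i < m) dot (row i M)^T (row i M)^T)) => x.
rewrite /enorm -sqrtrM; last by apply: sumr_ge0 => i _; exact: dotxx_ge0.
rewrite ler_wsqrtr// {1}/dot mulr_suml; apply: ler_sum => i _.
rewrite -expr2 (_ : (M *m x) i 0 = dot (row i M)^T x) ?cauchy_schwarz_sq//.
by rewrite !mxE; apply: eq_bigr => j _; rewrite !mxE.
Qed.

Lemma opnorm_has_sup m n (M : 'M[R]_(m, n)) :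
  has_sup [set enorm (M *m x) | x in [set x : 'cV[R]_n | enorm x <= 1]].
Proof.
have [C hC] := enorm_mulmx_bounded M; split.
  by exists (enorm (M *m 0)), 0 => //=; rewrite /enorm dot0r sqrtr0 ler01.
exists `|C| => _ [x /= hx <-]; apply: le_trans (hC x) _.
apply: le_trans (ler_wpM2r (enorm_ge0 x) (ler_norm C)) _.
by rewrite -[leRHS]mulr1 ler_wpM2l.
Qed.

Lemma opnorm_ge0 m n (M : 'M[R]_(m, n)) : 0 <= opnorm M.
Proof.
apply: le_trans (enorm_ge0 (M *m 0)) _; apply: ub_le_sup.
  by have [] := opnorm_has_sup M.
by exists 0 => //=; rewrite /enorm dot0r sqrtr0 ler01.
Qed.

Lemma enorm_mulmx_le m n (M : 'M[R]_(m, n)) (x : 'cV[R]_n) :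
  enorm (M *m x) <= opnorm M * enorm x.
Proof.
have [x0|xN0] := eqVneq (enorm x) 0.
  by rewrite (enorm0_eq0 x0) mulmx0 /enorm !dot0r sqrtr0 mulr0.
have xp : 0 < enorm x by rewrite lt_neqAle eq_sym xN0 enorm_ge0.
rewrite -ler_pdivrMr// mulrC.
have xi0 : 0 <= (enorm x)^-1 by rewrite invr_ge0 enorm_ge0.
rewrite -{1}(ger0_norm xi0) -enormZ scalemxAr; apply: ub_le_sup.
  by have [] := opnorm_has_sup M.
by exists ((enorm x)^-1 *: x) => //=; rewrite enormZ ger0_norm// mulVf.
Qed.

Lemma dot_mulmx_le m n (M : 'M[R]_(m, n)) (x : 'cV[R]_n) :
  dot (M *m x) (M *m x) <= opnorm M ^+ 2 * dot x x.
Proof.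
rewrite -!enormE -exprMn ler_pXn2r ?nnegrE ?mulr_ge0 ?enorm_ge0 ?opnorm_ge0 //.
exact: enorm_mulmx_le.
Qed.

(** Jensen's inequality for the squared norm: for N > 0 and s the sum, the squared norms of the
    vectors N f_k - s add up to N times the difference of the two sides. *)
Lemma dot_sum_le n (N : nat) (f : nat -> 'cV[R]_n) :
  dot (\sum_(1 <= k < N.+1) f k) (\sum_(1 <= k < N.+1) f k)
    <= N%:R * \sum_(1 <= k < N.+1) dot (f k) (f k).
Proof.
set s := \sum_(1 <= k < N.+1) f k.
case: N @s => [|N] s; first by rewrite /s !big_geq// dot0r mul0r.
have := sumr_ge0 (index_iota 1 N.+2) (fun k (_ : true) =>
  dotxx_ge0 (N.+1%:R *: f k - s)).
rewrite (eq_bigr (fun k => N.+1%:R * (N.+1%:R * dot (f k) (f k)) -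
   (2 * N.+1%:R) * dot s (f k) + dot s s)); last first.
  by move=> k _; rewrite !dotlin (dotC (f k) s); ring.
rewrite big_split sumrB /= -!mulr_sumr -dot_sumr -/s sumr_const_nat subSS subn0.
rewrite -[_ *+ N.+1]mulr_natl => h; rewrite -(ler_pM2l (ltr0Sn R N)).
by rewrite -subr_ge0; apply: le_trans h _; rewrite le_eqVlt; apply/orP; left; apply/eqP; ring.
Qed.

End DotTheory.

(** * Square roots of diagonal positive definite matrices *)

Section SquareRoot.
Context {R : realType} {n : nat}.
Variable M : 'M[R]_n.
Hypotheses (Mdiag : is_diag_mx M) (Mpos : posdef M).

Lemma posdef_unitmx : M \in unitmx.
Proof.
rewrite -row_free_unit -kermx_eq0; apply/eqP/row_matrixP => i; rewrite row0.
set v := row i _.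
have vM : v *m M = 0 by rewrite /v -row_mul mulmx_ker row0.
apply/eqP/negPn/negP => vN0; have := Mpos.2 v^T.
rewrite -(inj_eq trmx_inj) trmxK trmx0 => /(_ vN0).
by rewrite -(Mpos.1) -trmx_mul vM trmx0 dot0r ltxx.
Qed.

(** [mxsqrt] is a choice among roots, so its properties follow once one root is exhibited; for
    diagonal [M] the square roots of the diagonal entries provide it. *)
Lemma diag_posdef_sqrt : possemidef (mxsqrt M) /\ mxsqrt M *m mxsqrt M = M.
Proof.
apply: (@xgetPex _ 0 [set S : 'M[R]_n | possemidef S /\ S *m S = M]).
have /is_diag_mxP hd := Mdiag.
have Mii i : 0 <= M i i.
  have := Mpos.2 (delta_mx i 0); rewrite -colE.
  have -> : dot (delta_mx i 0) (col i M) = M i i.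
    rewrite /dot (bigD1 i) //= !mxE !eqxx mul1r big1 ?addr0// => j /negbTE ji.
    by rewrite !mxE ji mul0r.
  move=> h; apply/ltW/h; apply/eqP => /colP /(_ i) /eqP.
  by rewrite !mxE !eqxx oner_eq0.
pose D := \row_i Num.sqrt (M i i).
exists (diag_mx D); split; first split.
- by rewrite tr_diag_mx.
- move=> x; apply: sumr_ge0 => i _.
  by rewrite mul_diag_mx !mxE mulrCA mulr_ge0 ?sqrtr_ge0// -expr2 sqr_ge0.
- apply/matrixP => i j; rewrite mul_diag_mx !mxE.
  have [->|ij] := eqVneq i j; first by rewrite mulr1n -expr2 sqr_sqrtr.
  by rewrite mulr0n mulr0 hd.
Qed.

Lemma mxsqrt_tr : (mxsqrt M)^T = mxsqrt M.
Proof. by have [[]] := diag_posdef_sqrt. Qed.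

Lemma mxsqrt_mul : mxsqrt M *m mxsqrt M = M.
Proof. by have [] := diag_posdef_sqrt. Qed.

Lemma mxsqrt_unitmx : mxsqrt M \in unitmx.
Proof. by have := posdef_unitmx; rewrite -{1}mxsqrt_mul unitmx_mul => /andP[]. Qed.

Lemma invmx_mxsqrt_tr : (invmx (mxsqrt M))^T = invmx (mxsqrt M).
Proof. by rewrite trmx_inv mxsqrt_tr. Qed.

Lemma mxsqrtVV : invmx (mxsqrt M) *m invmx (mxsqrt M) = invmx M.
Proof.
have uS := mxsqrt_unitmx.
apply: (can_inj (mulKmx posdef_unitmx)).
rewrite mulmxV ?posdef_unitmx // -{1}mxsqrt_mul mulmxA -(mulmxA (mxsqrt M)).
by rewrite mulmxV // mulmx1 mulmxV.
Qed.

Lemma wnormsq_invmx (x : 'cV[R]_n) : wnormsq (invmx M) x =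
  dot (invmx (mxsqrt M) *m x) (invmx (mxsqrt M) *m x).
Proof. by rewrite /wnormsq -mxsqrtVV -mulmxA dot_mulmxr invmx_mxsqrt_tr. Qed.

Lemma dot_mxsqrt (x y : 'cV[R]_n) :
  dot (invmx (mxsqrt M) *m x) (mxsqrt M *m y) = dot x y.
Proof. by rewrite dot_mulmxr mxsqrt_tr mulmxA mulmxV ?mxsqrt_unitmx// mul1mx. Qed.

(** With S = M^(1/2), |x|^2 = <Sx | M^-1 Sx>. This converts residuals scaled by Gamma^(1/2) into
    plain Euclidean ones. *)
Lemma dot_le_opnorm_inv (x : 'cV[R]_n) :
  dot x x <= opnorm (invmx M) * dot (mxsqrt M *m x) (mxsqrt M *m x).
Proof.
have -> : dot x x = dot (mxsqrt M *m x) (invmx M *m (mxsqrt M *m x)).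
  rewrite -mxsqrtVV -mulmxA (mulmxA _ (mxsqrt M) x) mulVmx ?mxsqrt_unitmx//.
  by rewrite mul1mx dotC dot_mxsqrt.
apply: le_trans (cauchy_schwarz _ _) _.
apply: le_trans (ler_wpM2l (enorm_ge0 _) (enorm_mulmx_le _ _)) _.
by rewrite mulrCA -expr2 enormE.
Qed.

(** On the unit ball |M^(1/2) x|^2 = <Mx | x> <= |Mx| |x|. This replaces |Gamma^(1/2)|^2 by |Gamma|
    in the feasibility estimate. *)
Lemma opnorm_mxsqrt_le : opnorm (mxsqrt M) ^+ 2 <= opnorm M.
Proof.
have [[y0 y0s] _] := opnorm_has_sup (mxsqrt M).
rewrite -[leRHS](sqr_sqrtr (opnorm_ge0 M)) ler_pXn2r ?nnegrE ?opnorm_ge0 ?sqrtr_ge0//.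
apply: ge_sup; first by exists y0.
move=> _ [x /= x1 <-]; rewrite ler_wsqrtr//.
rewrite dot_mulmxr mxsqrt_tr mulmxA mxsqrt_mul.
apply: le_trans (cauchy_schwarz _ _) _; rewrite -[leRHS]mulr1.
apply: ler_pM => //; rewrite ?enorm_ge0 //.
apply: le_trans (enorm_mulmx_le _ _) _; rewrite -[leRHS]mulr1.
by rewrite ler_wpM2l ?opnorm_ge0.
Qed.

End SquareRoot.

(** * One-step energy inequality and the resulting scalar recursion *)

Section Energy.
Context {R : realType}.

(* For a < 1, (1 - a) times the difference of the two sides is at least
   the squared norm of (1 - a) s - a w. *)
Lemma dot_addl_contraction n (a D : R) (s w : 'cV[R]_n) :
  0 < a -> a <= 1 -> 0 <= D -> dot w w <= (1 - a) * D ->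
  a * dot (s + w) (s + w) <= dot s s + a * D.
Proof.
move=> a0 a1 D0 hw; have ww := dotxx_ge0 w.
have [aE|aN1] := eqVneq a 1.
  have -> : w = 0.
    by apply: dotxx_eq0; apply/eqP; rewrite eq_le ww (le_trans hw)// aE subrr mul0r.
  by rewrite addr0 aE !mul1r lerDl.
have := dotxx_ge0 ((1 - a) *: s - a *: w).
rewrite !dotlin (dotC w s) => h.
have a1' : 0 < 1 - a by rewrite subr_gt0 lt_neqAle aN1.
rewrite -(ler_pM2l a1').
have := ler_wpM2l (ltW a0) hw.
lra.
Qed.

(* One iteration for a saddle point (x, u), in the coordinates
   y = Sigma^(-1/2) (p^k - x), v = Gamma^(-1/2) (u^k - u) and
   w = Gamma^(1/2) A (x^k - p^(k-1)); y1 has x^(k+1) in place of p^k. *)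
Lemma energy_step n m (a gap : R) (y y1 : 'cV[R]_n)
    (v v1 w w1 eta : 'cV[R]_m) :
  dot w1 w1 <= (1 - a) * dot (y1 - y) (y1 - y) ->
  gap <= dot (y - y1) y1 - dot v1 (v1 - v - w + w1 + eta) ->
  gap + dot y1 y1 / 2 + dot (v1 + w1) (v1 + w1) / 2
      + a * dot (y1 - y) (y1 - y) / 2 + dot (v1 - v - w) (v1 - v - w) / 2
    <= dot y y / 2 + dot (v + w) (v + w) / 2 - dot v1 eta.
Proof.
(* Polarizing <y - y1 | y1>, <v1 | v1 - v - w> and <v1 | w1> produces all the squares. The leftover
   |w1|^2 / 2 is absorbed by |y1 - y|^2 / 2, of which the fraction [a] survives. *)
rewrite !dotlin (dotC y1 y) (dotC w v) (dotC w1 v1) (dotC v1 v) (dotC w v1).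
lra.
Qed.

Lemma sqrtr_add_le (x y : R) : 0 <= x -> 0 <= y ->
  Num.sqrt (x + y) <= Num.sqrt x + Num.sqrt y.
Proof.
move=> x0 y0; rewrite -(@ler_pXn2r _ 2) ?nnegrE ?addr_ge0 ?sqrtr_ge0//.
rewrite sqr_sqrtr ?addr_ge0// sqrrD !sqr_sqrtr//.
by rewrite -addrA lerD2l lerDr mulrn_wge0 // mulr_ge0 ?sqrtr_ge0.
Qed.

Section Recursion.
(** To be used with [c] = e delta^2 / 2, [lam] = delta |Gamma^(1/2)|, [rho] the squared scaled
    residuals and [q] the norms |v_k|. *)
Variables (N : nat) (a c lam V0 : R) (Phi gap rho q : nat -> R).
Hypotheses (a0 : 0 < a) (c0 : 0 <= c) (lam0 : 0 <= lam) (V00 : 0 <= V0).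
Hypotheses (Phi_ge0 : forall k, 0 <= Phi k) (gap_ge0 : forall k, 0 <= gap k.+1).
Hypotheses (rho_ge0 : forall k, 0 <= rho k) (q_ge0 : forall k, 0 <= q k).
Hypothesis Phi0 : Phi 0%N <= V0.
Hypothesis Phi_step : forall k,
  gap k.+1 + a * rho k.+1 / 2 + Phi k.+1 <= Phi k + c + lam * q k.+1.
Hypothesis q_step : forall k, a * q k.+1 ^+ 2 / 2 <= Phi k + lam * q k.+1.

(** Dominates the positive root of a q^2 / 2 = lam N q + V0 + N c, with the square root split over
    the two constants. *)
Let Q := 2 * lam * N%:R / a + Num.sqrt (2 * V0 / a)
         + Num.sqrt (2 * N%:R * c / a).

Lemma energy_sum n :
  \sum_(1 <= k < n.+1) gap k + a * (\sum_(1 <= k < n.+1) rho k) / 2 + Phi n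
    <= V0 + n%:R * c + lam * \sum_(1 <= k < n.+1) q k.
Proof.
elim: n => [|n IH]; first by rewrite !big_geq// !(mulr0, mul0r) !addr0 !add0r.
have := Phi_step n.
rewrite !(big_nat_recr n.+1)//= -[n.+1%:R]natr1; lra.
Qed.

(** If q = q_(n+1) exceeded Q, it would dominate all earlier q_k, so [q_step] and [energy_sum] would
    give q (q - tau) <= S; but Q < q forces q > sqrt S + tau, hence q (q - tau) > S. *)
Lemma q_bound n : (n <= N)%N -> forall k, (0 < k <= n)%N -> q k <= Q.
Proof.
elim: n => [|n IH] nN k; first by case: k.
move=> /andP[k0]; rewrite leq_eqVlt => /orP[/eqP ->{k k0}|kn]; last first.
  by apply: (IH (ltnW nN)); rewrite k0.
have sq : \sum_(1 <= k < n.+1) q k <= n%:R * Q.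
  rewrite -[n in n%:R]subn0 -subSS mulr_natl -sumr_const_nat.
  rewrite !big_seq; apply: ler_sum => k; rewrite mem_index_iota => /andP[k0 kn].
  by apply: (IH (ltnW nN)); rewrite k0.
have hS := energy_sum n; have hq := q_step n.
have g0 : 0 <= \sum_(1 <= k < n.+1) gap k.
  by rewrite big_seq; apply: sumr_ge0 => -[|k] //; rewrite mem_index_iota.
have r0 : 0 <= a * (\sum_(1 <= k < n.+1) rho k) / 2.
  by rewrite divr_ge0// mulr_ge0 ?(ltW a0)//; apply: sumr_ge0.
rewrite leNgt; apply/negP => Qq.
have nN' : n%:R + 1 <= N%:R :> R by rewrite natr1 ler_nat.
set S := 2 * V0 / a + 2 * N%:R * c / a.
have S1 : 0 <= 2 * V0 / a by rewrite divr_ge0 ?mulr_ge0 ?(ltW a0).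
have S2 : 0 <= 2 * N%:R * c / a by rewrite divr_ge0 ?mulr_ge0 ?ler0n ?(ltW a0).
set tau := 2 * lam * N%:R / a.
have tau0 : 0 <= tau by rewrite divr_ge0 ?mulr_ge0 ?ler0n ?(ltW a0).
have Qt : Num.sqrt S + tau < q n.+1.
  apply: le_lt_trans Qq; rewrite /Q -/tau addrC -addrA lerD2l.
  exact: sqrtr_add_le.
have le1 : q n.+1 * (q n.+1 - tau) <= S.
  have nq : n%:R * Q <= n%:R * q n.+1 by rewrite ler_wpM2l ?ler0n ?ltW.
  have h1 : a * q n.+1 ^+ 2 / 2 <= V0 + N%:R * c + lam * (N%:R * q n.+1).
    have : lam * \sum_(1 <= k < n.+1) q k <= lam * (n%:R * q n.+1).
      by rewrite ler_wpM2l// (le_trans sq).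
    have : lam * (n%:R * q n.+1 + q n.+1) <= lam * (N%:R * q n.+1).
      by rewrite ler_wpM2l// -[X in _ + X]mul1r -mulrDl ler_wpM2r.
    have : n%:R * c <= N%:R * c by rewrite ler_wpM2r// ler_nat ltnW.
    lra.
  rewrite -(ler_pM2l a0).
  have -> : a * (q n.+1 * (q n.+1 - tau)) =
      a * q n.+1 ^+ 2 - 2 * (lam * (N%:R * q n.+1)).
    by rewrite /tau; field; rewrite gt_eqF.
  have -> : a * S = 2 * V0 + 2 * (N%:R * c) by rewrite /S; field; rewrite gt_eqF.
  lra.
have sS : 0 <= Num.sqrt S by exact: sqrtr_ge0.
have : S < q n.+1 * (q n.+1 - tau).
  rewrite -[S in ltLHS]sqr_sqrtr ?addr_ge0// expr2.
  have := ltr_pM sS sS (y1 := q n.+1) (y2 := q n.+1 - tau); apply; lra.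
by rewrite ltNge le1.
Qed.

Lemma energy_bound :
  \sum_(1 <= k < N.+1) gap k + a * (\sum_(1 <= k < N.+1) rho k) / 2
    <= V0 + N%:R * c + lam * (N%:R * Q).
Proof.
apply: le_trans (_ : _ <= V0 + N%:R * c + lam * \sum_(1 <= k < N.+1) q k) _.
  by apply: le_trans (energy_sum N); rewrite lerDl.
rewrite lerD2l ler_wpM2l// -[N in N%:R]subn0 -subSS mulr_natl -sumr_const_nat.
rewrite !big_seq; apply: ler_sum => k; rewrite mem_index_iota.
exact: (q_bound (leqnn N)).
Qed.

End Recursion.
End Energy.

(** Induction from two-point convexity with weight t = (n+1)/(n+2) on the previous mean. Finiteness
    is asked from index 1 on, since [J] may be infinite at the starting point of the iteration. *)
Lemma econvex_mean (R : realType) p (J : 'cV[R]_p -> \bar R)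
    (x : nat -> 'cV[R]_p) (F : nat -> R) (n : nat) :
  econvex J -> (forall k, J (x k.+1) = (F k.+1)%:E) -> (0 < n)%N ->
  (J (n%:R^-1 *: \sum_(1 <= k < n.+1) x k)
     <= (n%:R^-1 * \sum_(1 <= k < n.+1) F k)%:E)%E.
Proof.
move=> cJ hF; case: n => // n _; elim: n => [|n IH].
  by rewrite !big_nat1 invr1 scale1r mul1r hF.
rewrite !(big_nat_recr n.+2)//=.
set X := \sum_(1 <= k < n.+2) x k in IH *.
set Y := \sum_(1 <= k < n.+2) F k in IH *.
set t : R := n.+1%:R / n.+2%:R.
have n1 : n.+1%:R != 0 :> R by rewrite pnatr_eq0.
have n2 : n.+2%:R != 0 :> R by rewrite pnatr_eq0.
have t1 : 1 - t = n.+2%:R^-1.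
  by move: n2; rewrite /t -[n.+2%:R]natr1 => n2; field.
have t0 : 0 < t by rewrite divr_gt0 ?ltr0n.
have tn : t / n.+1%:R = n.+2%:R^-1 by rewrite /t mulrAC mulfV// mul1r.
have tlt : t < 1 by rewrite -subr_gt0 t1 invr_gt0 ltr0n.
have := cJ (n.+1%:R^-1 *: X) (x n.+2) t; rewrite t0 tlt => /(_ isT).
rewrite scalerA tn t1 hF -scalerDr => /le_trans; apply.
rewrite mulrDr EFinD -EFinM leeD2r// -tn -mulrA [leRHS]EFinM.
by rewrite lee_wpmul2l // lee_fin ltW.
Qed.

(** * Optimality conditions: saddle points and the proximal step *)

Section Saddle.
Context {R : realType} {p d : nat}.
Variables (J : 'cV[R]_p -> \bar R) (A : 'M[R]_(d, p)) (b : 'cV[R]_d).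
Variable z : 'cV[R]_p * 'cV[R]_d.
Hypotheses (pJ : Defs.proper J) (hz : saddle_points J A b z).

Lemma saddle_fin : J z.1 \is a fin_num.
Proof.
have [JN [y hy]] := pJ.
have [_] := hz y z.2; rewrite /lagrangian.
rewrite fin_numE JN /=; move: hy (JN y) (JN z.1).
by case: (J y) (J z.1) => [r||] [s||].
Qed.

(** Testing the multiplier u + (Ax - b) in the left saddle inequality gives |Ax - b|^2 <= 0. *)
Lemma saddle_feasible : A *m z.1 = b.
Proof.
have [+ _] := hz 0 (z.2 + (A *m z.1 - b)).
rewrite /lagrangian -(fineK saddle_fin) -!EFinD lee_fin lerD2l dotDl gerDl => h.
by apply/eqP; rewrite -subr_eq0; apply/eqP/dotxx_eq0/eqP; rewrite eq_le h dotxx_ge0.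
Qed.

Lemma saddle_min (y : 'cV[R]_p) :
  (J z.1 <= J y + (dot z.2 (A *m y - b))%:E)%E.
Proof.
have [_] := hz y z.2.
by rewrite /lagrangian saddle_feasible subrr dot0r adde0.
Qed.

Lemma saddle_minimizer : minimizers J A b z.1.
Proof.
split; first exact: saddle_feasible.
  by rewrite -(fineK saddle_fin) ltry.
by move=> y hy; have := saddle_min y; rewrite hy subrr dot0r adde0.
Qed.

End Saddle.

(** The subgradient inequality at [x] tested at [y], with subgradient g = Sigma^-1 (q - x) - h; the
    same inequality makes [J x] finite. *)
Lemma prox_ineq (R : realType) p (J : 'cV[R]_p -> \bar R) (Sigma : 'M[R]_p)
    (q h x y : 'cV[R]_p) :
  Defs.proper J -> is_diag_mx Sigma -> posdef Sigma -> J y \is a fin_num ->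
  prox Sigma J (q - Sigma *m h) x ->
  J x \is a fin_num /\
  fine (J x) - fine (J y)
    <= dot (invmx (mxsqrt Sigma) *m (q - x)) (invmx (mxsqrt Sigma) *m (x - y))
       - dot h (x - y).
Proof.
move=> [JN _] Sd Sp fy [g hg e].
have fx : J x \is a fin_num.
  have := hg y; rewrite fin_numE JN /= -(fineK fy); move: (JN x).
  by case: (J x).
split=> //.
have -> : dot (invmx (mxsqrt Sigma) *m (q - x)) (invmx (mxsqrt Sigma) *m (x - y))
    = dot (g + h) (x - y).
  rewrite dot_mulmxr invmx_mxsqrt_tr// mulmxA mxsqrtVV//.
  have -> : q - x = Sigma *m (g + h).
    by rewrite mulmxDr -[q](subrK (Sigma *m h)) e addrAC [x + _]addrC addrK.
  by rewrite mulKmx// posdef_unitmx.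
have := hg y; rewrite -(fineK fx) -(fineK fy) -EFinD lee_fin /=.
by rewrite -(opprB x y) !dotlin; lra.
Qed.

Lemma ergodicE (R : realType) p d (x : nat -> 'cV[R]_p) (u : nat -> 'cV[R]_d)
    (N : nat) :
  ergodic (fun k => (x k, u k)) N =
  (N%:R^-1 *: \sum_(1 <= k < N.+1) x k, N%:R^-1 *: \sum_(1 <= k < N.+1) u k).
Proof.
rewrite /ergodic; set s := \sum_(1 <= k < N.+1) (x k, u k).
rewrite [s]surjective_pairing /s.
by rewrite (big_morph fst (fun _ _ => erefl) erefl)
  (big_morph snd (fun _ _ => erefl) erefl).
Qed.

Lemma mean_residual (R : realType) p d (A : 'M[R]_(d, p)) (c : 'cV[R]_d)
    (x : nat -> 'cV[R]_p) (n : nat) : (0 < n)%N ->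
  A *m (n%:R^-1 *: \sum_(1 <= k < n.+1) x k) - c =
  n%:R^-1 *: \sum_(1 <= k < n.+1) (A *m x k - c).
Proof.
move=> n0.
rewrite sumrB -mulmx_sumr -scalemxAr sumr_const_nat subSS subn0 scalerBr.
by rewrite -[c *+ _]scaler_nat scalerA mulVf ?pnatr_eq0 -?lt0n// scale1r.
Qed.

Theorem theorem4p1 (R : realType) (p d : nat)
  (A : 'M[R]_(d, p)) (b : 'cV[R]_d) (J : 'cV[R]_p -> \bar R)
  (hJ : Gamma0 J)
  (hS : minimizers J A b !=set0)
  (hZ : saddle_points J A b !=set0)
  (delta : R) (hdelta : 0 <= delta)
  (bd : 'cV[R]_d) (hbd : enorm (bd - b) <= delta)
  (Sigma : 'M[R]_p) (Gamma : 'M[R]_d)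
  (hSigma_diag : is_diag_mx Sigma) (hSigma : posdef Sigma)
  (hGamma_diag : is_diag_mx Gamma) (hGamma : posdef Gamma)
  (halpha : 0 < alpha Sigma Gamma A)
  (m : nat) (hm : (1 <= m)%N) (eps : nat -> 'I_m)
  (T : 'I_m -> 'cV[R]_p -> 'cV[R]_p)
  (hTfix : forall i : 'I_m, minimizers J A bd `<=` Fix (T i))
  (ei : 'I_m -> R) (hei : forall i : 'I_m, 0 <= ei i)
  (hT : forall (i : 'I_m) (x xbar : 'cV[R]_p), minimizers J A b xbar ->
     wnormsq (invmx Sigma) (T i x - xbar)
       <= wnormsq (invmx Sigma) (x - xbar) + ei i * delta ^+ 2)
  (ps pbars xs : nat -> 'cV[R]_p) (us : nat -> 'cV[R]_d)
  (hp0 : ps 0%N = pbars 0%N) (hx0 : xs 0%N = ps 0%N)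
  (hu : forall k : nat, us k.+1 = us k + Gamma *m (A *m pbars k - bd))
  (hx : forall k : nat,
     prox Sigma J (ps k - Sigma *m (A^T *m us k.+1)) (xs k.+1))
  (hp : forall k : nat, ps k.+1 = T (eps k.+1) (xs k.+1))
  (hpbar : forall k : nat, pbars k.+1 = ps k.+1 + xs k.+1 - ps k)
  (z : 'cV[R]_p * 'cV[R]_d) (hz : saddle_points J A b z)
  (N : nat) (hN : (1 <= N)%N) :
  let zs := fun k : nat => (xs k, us k) in
  let XN := (ergodic zs N).1 in
  let UN := (ergodic zs N).2 in
  let e := \big[Num.max/0]_(i < m) ei i in
  let a := alpha Sigma Gamma A in
  let V0 := Vfun Sigma Gamma (zs 0%N - z) in
  let g := opnorm (mxsqrt Gamma) in
  let G := opnorm Gamma in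
  let Gi := opnorm (invmx Gamma) in
  (lagrangian J A b XN z.2 - lagrangian J A b z.1 UN
    <= (V0 / N%:R
        + 2 * N%:R * g ^+ 2 * delta ^+ 2 / a
        + delta * g * Num.sqrt (2 * V0 / a)
        + delta * g * Num.sqrt (N%:R * e * delta ^+ 2 / a)
        + e * delta ^+ 2 / 2)%:E)%E
  /\
  enorm (A *m XN - b) ^+ 2
    <= 16 * N%:R * G * Gi * delta ^+ 2 / a ^+ 2
       + 8 * delta * Gi * Num.sqrt (2 * G * V0 / a ^+ 3)
       + 8 * delta ^+ 2 * Gi * Num.sqrt (G * e * N%:R / a ^+ 3)
       + 8 * Gi * V0 / (N%:R * a)
       + 2 * delta ^+ 2
       + 4 * Gi * e * delta ^+ 2 / a.
Proof.
move=> zs XN UN e a V0 g G Gi.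
have [pJ cJ _] := hJ.
have Jf := saddle_fin pJ hz.
have Axb := saddle_feasible pJ hz.
set xb := z.1 in Jf Axb *; set ub := z.2.
set f := fine (J xb).

(* Scaled coordinates around the saddle point and one iteration *)
set S := mxsqrt Gamma in g *; set H := mxsqrt Sigma.
have uS : S \in unitmx by exact: mxsqrt_unitmx.
have uH : H \in unitmx by exact: mxsqrt_unitmx.
(* The extrapolation term; its value 0 at index 0 encodes the equality of the two initial points and
   makes [w 0] vanish, which [Phi0] uses. *)
pose D k := if k is j.+1 then xs k - ps j else 0.
pose F k := fine (J (xs k)).
pose y k := invmx H *m (ps k - xb).
pose y1 k := invmx H *m (xs k - xb).
pose v k := invmx S *m (us k - ub).
pose w k := S *m (A *m D k).
pose r k := S *m (A *m xs k - bd).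
pose eta := S *m (bd - b).
have pbE k : pbars k = ps k + D k.
  by case: k => [|k]; rewrite /= ?addr0 ?hp0// hpbar addrA.
have rE k : r k.+1 = v k.+1 - v k - w k + w k.+1.
  rewrite /v -mulmxBr opprB addrA subrK hu [us k + _]addrC addrK.
  rewrite -[Gamma](mxsqrt_mul hGamma_diag hGamma) -/S -mulmxA mulKmx//.
  rewrite /r /w -mulmxBr -mulmxDr; congr (S *m _).
  have -> : xs k.+1 = pbars k - D k + D k.+1 by rewrite pbE addrK /= addrC subrK.
  by rewrite mulmxDr mulmxBr addrAC; congr (_ + _); exact: addrAC.
have wD k : dot (w k.+1) (w k.+1)
    <= (1 - a) * dot (y1 k.+1 - y k) (y1 k.+1 - y k).
  have -> : 1 - a = opnorm (S *m A *m H) ^+ 2 by rewrite /a /alpha subKr.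
  have -> : w k.+1 = (S *m A *m H) *m (y1 k.+1 - y k).
    rewrite /y1 /y -mulmxBr opprB addrA subrK mulmxA -(mulmxA _ H) mulmxV// mulmx1.
    by rewrite /w mulmxA.
  exact: dot_mulmx_le.
have a1 : a <= 1 by rewrite gerBl sqr_ge0.
have g0 : 0 <= g := opnorm_ge0 _.
have e0 : 0 <= e by exact: bigmax_ge_id.
have d2 : 0 <= delta ^+ 2 by exact: sqr_ge0.
have etag : enorm eta <= delta * g.
  apply: le_trans (enorm_mulmx_le _ _) _.
  by rewrite mulrC ler_wpM2r.
have hx' k : J (xs k.+1) \is a fin_num /\
    F k.+1 - f <= dot (y k - y1 k.+1) (y1 k.+1)
                  - dot (us k.+1) (A *m xs k.+1 - b).
  have [fx] := prox_ineq pJ hSigma_diag hSigma Jf (hx k).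
  rewrite -dot_mulmxr (mulmxBr A) Axb; split=> //.
  by rewrite /y /y1 -mulmxBr opprB addrA subrK.
(* As A xb = b, the Lagrangian at [xb] equals [f] for every multiplier, so this is the full gap of
   the k-th iterate. *)
pose gap k := F k - f + dot ub (A *m xs k - b).
have gap0 k : 0 <= gap k.+1.
  have := saddle_min pJ hz (xs k.+1).
  rewrite -(fineK Jf) -(fineK (hx' k).1) -EFinD lee_fin /gap -/f -/(F _) -/ub.
  by lra.
have step k : gap k.+1 + dot (y1 k.+1) (y1 k.+1) / 2
      + dot (v k.+1 + w k.+1) (v k.+1 + w k.+1) / 2
      + a * dot (y1 k.+1 - y k) (y1 k.+1 - y k) / 2
      + dot (v k.+1 - v k - w k) (v k.+1 - v k - w k) / 2
    <= dot (y k) (y k) / 2 + dot (v k + w k) (v k + w k) / 2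
       + delta * g * enorm (v k.+1).
  have ve : - dot (v k.+1) eta <= delta * g * enorm (v k.+1).
    rewrite -dotNr; apply: le_trans (cauchy_schwarz _ _) _.
    rewrite mulrC ler_wpM2r ?enorm_ge0//.
    by rewrite -scaleN1r enormZ normrN normr1 mul1r.
  apply: le_trans (energy_step (eta := eta) (wD k) _) _; last by lra.
  rewrite -rE -mulmxDr addrA subrK dot_mxsqrt//.
  by have [_] := hx' k; rewrite /gap (dotDl (us k.+1)) dotNl; lra.
pose Phi k := dot (y k) (y k) / 2 + dot (v k + w k) (v k + w k) / 2.
have half_ge0 n (x : 'cV[R]_n) : 0 <= dot x x / 2 by rewrite divr_ge0 ?dotxx_ge0.
have Tstep k : dot (y k.+1) (y k.+1) <= dot (y1 k.+1) (y1 k.+1) + e * delta ^+ 2.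
  have := hT (eps k.+1) (xs k.+1) xb (saddle_minimizer pJ hz).
  rewrite !wnormsq_invmx// -hp => /le_trans; apply.
  by rewrite lerD2l ler_wpM2r//; exact: le_bigmax.
have V00 : 0 <= V0.
  by rewrite /V0 /Vfun !wnormsq_invmx// addr_ge0// mulr_ge0 ?dotxx_ge0.
have Phi0 : Phi 0%N <= V0.
  rewrite /Phi /V0 /Vfun !wnormsq_invmx// /w /= !mulmx0 addr0 /y /v -hx0.
  by rewrite !(mulrC 2^-1).
have Phistep k : gap k.+1 + a * dot (r k.+1) (r k.+1) / 2 + Phi k.+1
    <= Phi k + e * delta ^+ 2 / 2 + delta * g * enorm (v k.+1).
  (* By [rE] the residual is (v_(k+1) - v_k - w_k) + w_(k+1), and the squares needed to bound it are
     on the left of [step]. *)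
  have := dot_addl_contraction (v k.+1 - v k - w k) halpha a1 (dotxx_ge0 _) (wD k).
  rewrite -rE /Phi; have := step k; have := Tstep k; rewrite -/a; lra.
have qstep k : a * enorm (v k.+1) ^+ 2 / 2 <= Phi k + delta * g * enorm (v k.+1).
  have wN : dot (- w k.+1) (- w k.+1)
      <= (1 - a) * dot (y1 k.+1 - y k) (y1 k.+1 - y k).
    by rewrite dotNl dotNr opprK.
  (* Here v_(k+1) = (v_(k+1) + w_(k+1)) + (- w_(k+1)), and the first summand is controlled through
     [step]. *)
  have := dot_addl_contraction (v k.+1 + w k.+1) halpha a1 (dotxx_ge0 _) wN.
  rewrite addrK enormE /Phi.
  have := step k; have := gap0 k; have := half_ge0 _ (y1 k.+1).
  have := half_ge0 _ (v k.+1 - v k - w k); rewrite -/a; lra.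
have c0 : 0 <= e * delta ^+ 2 / 2 by rewrite divr_ge0 ?mulr_ge0.
have lam0 : 0 <= delta * g by rewrite mulr_ge0.
have Phige k : 0 <= Phi k by rewrite addr_ge0.

(* Summation over the iterations *)
have := energy_bound N halpha c0 lam0 V00 Phige gap0
  (fun k => dotxx_ge0 (r k)) (fun k => enorm_ge0 (v k)) Phi0 Phistep qstep.
rewrite -/a (_ : 2 * N%:R * (e * delta ^+ 2 / 2) = N%:R * e * delta ^+ 2);
  last by field.
set Q := _ + _ + Num.sqrt _ => bound.
have a0 : 0 < a := halpha.
have gapS0 : 0 <= \sum_(1 <= k < N.+1) gap k.
  by rewrite big_seq; apply: sumr_ge0 => -[|k] //; rewrite mem_index_iota.
have rhoS0 : 0 <= \sum_(1 <= k < N.+1) dot (r k) (r k).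
  by apply: sumr_ge0 => k _; exact: dotxx_ge0.

have N0 : 0 < N%:R :> R by rewrite ltr0n.
have Ni0 : 0 <= N%:R^-1 :> R by rewrite invr_ge0 ltW.
have XNE : XN = N%:R^-1 *: \sum_(1 <= k < N.+1) xs k by rewrite /XN ergodicE.
have rhobound : a * (\sum_(1 <= k < N.+1) dot (r k) (r k)) / 2
    <= V0 + N%:R * (e * delta ^+ 2 / 2) + delta * g * (N%:R * Q).
  by apply: le_trans bound; rewrite lerDr.

(* Ergodic estimate of the Lagrangian gap *)
split.
  have JX : (J XN <= (N%:R^-1 * \sum_(1 <= k < N.+1) F k)%:E)%E.
    rewrite XNE; apply: econvex_mean => // k.
    by rewrite fineK //; exact: (hx' k).1.
  have JXf : J XN \is a fin_num.
    by move: JX (pJ.1 XN); rewrite fin_numE; case: (J XN).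
  have gapE : N%:R^-1 * \sum_(1 <= k < N.+1) gap k =
      N%:R^-1 * \sum_(1 <= k < N.+1) F k - f + dot ub (A *m XN - b).
    rewrite XNE mean_residual// dotZr dot_sumr big_split sumrB /= !mulrDr.
    congr (_ + _ + _); rewrite sumr_const_nat subSS subn0 mulrN -[f *+ N]mulr_natl.
    by rewrite mulKf// gt_eqF.
  rewrite /lagrangian Axb subrr dot0r adde0.
  move: JX; rewrite -(fineK JXf) -(fineK Jf) -EFinD !lee_fin => JX.
  apply: le_trans (_ : N%:R^-1 * \sum_(1 <= k < N.+1) gap k <= _).
    by rewrite gapE -/f -/ub; lra.
  apply: le_trans (_ : N%:R^-1 *
      (V0 + N%:R * (e * delta ^+ 2 / 2) + delta * g * (N%:R * Q)) <= _).
    rewrite ler_wpM2l//; apply: le_trans bound.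
    by rewrite lerDl divr_ge0// mulr_ge0// ltW.
  (* Dividing the summed bound by N and expanding [Q] gives the claimed right-hand side exactly. *)
  rewrite le_eqVlt; apply/orP; left; apply/eqP.
  rewrite /Q; move: (Num.sqrt _) (Num.sqrt _) => sV sE.
  by field; rewrite !gt_eqF.

(* Ergodic estimate of the feasibility residual *)
have res : enorm (A *m XN - bd) ^+ 2
    <= Gi * (N%:R^-1 * \sum_(1 <= k < N.+1) dot (r k) (r k)).
  rewrite enormE XNE mean_residual// dotZl dotZr.
  rewrite [leRHS]mulrCA ler_wpM2l// ler_pdivrMl// (le_trans (dot_sum_le _ _))//.
  rewrite ler_wpM2l ?ler0n// mulr_sumr; apply: ler_sum => k _.
  exact: dot_le_opnorm_inv.
have split_le : enorm (A *m XN - b) ^+ 2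
    <= 2 * enorm (A *m XN - bd) ^+ 2 + 2 * delta ^+ 2.
  have db : enorm (bd - b) ^+ 2 <= delta ^+ 2.
    by rewrite ler_pXn2r ?nnegrE ?enorm_ge0.
  have -> : A *m XN - b = (A *m XN - bd) + (bd - b) by rewrite addrA subrK.
  have := dotxx_ge0 ((A *m XN - bd) - (bd - b)).
  move: db; rewrite !enormE.
  move: (A *m XN - bd) (bd - b) => s t; rewrite !dotlin (dotC t s).
  lra.
have gG : g ^+ 2 <= G by exact: opnorm_mxsqrt_le.
have Gi0 : 0 <= Gi := opnorm_ge0 _.
(* Moves the factor g / a under the root, where g^2 <= G applies; this is the origin of the a^3. *)
have sqrt_le t : 0 <= t ->
    g * Num.sqrt (t / a) / a <= Num.sqrt (G * t / a ^+ 3).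
  move=> t0; have h0 : 0 <= g * Num.sqrt (t / a) / a.
    by rewrite divr_ge0 ?(ltW a0)// mulr_ge0// sqrtr_ge0.
  rewrite -[leLHS](ger0_norm h0) -sqrtr_sqr ler_wsqrtr//.
  rewrite !exprMn sqr_sqrtr; last by rewrite divr_ge0// ltW.
  rewrite -mulrA -(mulrA G) (_ : t / a * a^-1 ^+ 2 = t / a ^+ 3); last first.
    by field; rewrite gt_eqF.
  by rewrite ler_wpM2r// divr_ge0// exprn_ge0// ltW.
have sV : g * Num.sqrt (2 * V0 / a) / a <= Num.sqrt (2 * G * V0 / a ^+ 3).
  by rewrite (mulrC 2 G) -(mulrA G); apply: sqrt_le; rewrite mulr_ge0.
have sE : g * Num.sqrt (N%:R * e * delta ^+ 2 / a) / a
    <= delta * Num.sqrt (G * e * N%:R / a ^+ 3).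
  rewrite (_ : N%:R * e * delta ^+ 2 / a = delta ^+ 2 * (e * N%:R / a)); last by ring.
  rewrite sqrtrM// sqrtr_sqr (ger0_norm hdelta) -(mulrA G).
  rewrite (mulrCA g) -(mulrA delta) ler_wpM2l// sqrt_le// mulr_ge0// ltW.
(* The terms of the bound are named so that the final comparison becomes linear. *)
set P1 := V0 / (N%:R * a); set P2 := e * delta ^+ 2 / a.
set P3 := N%:R * delta ^+ 2 / a ^+ 2.
have P10 : 0 <= P1 by rewrite divr_ge0// mulr_ge0// ltW.
have P20 : 0 <= P2 by rewrite divr_ge0 ?mulr_ge0// ltW.
have P30 : 0 <= P3 by rewrite divr_ge0 ?exprn_ge0 ?mulr_ge0// ltW.
move: sV sE; set sq1 := Num.sqrt (2 * G * V0 / a ^+ 3).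
set sq2 := Num.sqrt (G * e * N%:R / a ^+ 3).
set T1 := g * _ / a; set T2 := g * _ / a => hT1 hT2.
have T10 : 0 <= T1 by rewrite divr_ge0 ?(ltW a0)// mulr_ge0// sqrtr_ge0.
have T20 : 0 <= T2 by rewrite divr_ge0 ?(ltW a0)// mulr_ge0// sqrtr_ge0.
have rhoP : N%:R^-1 * \sum_(1 <= k < N.+1) dot (r k) (r k)
    <= 2 * (P1 + P2 / 2 + 2 * (g ^+ 2 * P3) + delta * T1 + delta * T2).
  rewrite ler_pdivrMl// -(ler_pM2l a0).
  have -> : a * (N%:R * (2 * (P1 + P2 / 2 + 2 * (g ^+ 2 * P3)
        + delta * T1 + delta * T2))) =
      2 * (V0 + N%:R * (e * delta ^+ 2 / 2) + delta * g * (N%:R * Q)).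
    rewrite /P1 /P2 /P3 /T1 /T2 /Q.
    move: (Num.sqrt _) (Num.sqrt _) => s1 s2.
    by field; rewrite !gt_eqF.
  lra.
have -> : 16 * N%:R * G * Gi * delta ^+ 2 / a ^+ 2 = Gi * (16 * (G * P3)).
  by rewrite /P3; ring.
have -> : 8 * Gi * V0 / (N%:R * a) = Gi * (8 * P1) by rewrite /P1; ring.
have -> : 4 * Gi * e * delta ^+ 2 / a = Gi * (4 * P2) by rewrite /P2; ring.
have -> : 8 * delta * Gi * sq1 = Gi * (8 * (delta * sq1)) by ring.
have -> : 8 * delta ^+ 2 * Gi * sq2 = Gi * (8 * (delta * (delta * sq2))) by ring.
have := ler_wpM2l hdelta hT1; have := ler_wpM2l hdelta hT2.
have := mulr_ge0 hdelta T10; have := mulr_ge0 hdelta T20.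
have := ler_wpM2r P30 gG; have := mulr_ge0 (sqr_ge0 g) P30.
move=> h1 h2 h3 h4 h5 h6.
(* The factor 2 comes from [split_le]. The coefficients on the right are twice those that [rhoP]
   yields, so nonnegativity of the terms closes the gap. *)
have : 2 * (N%:R^-1 * \sum_(1 <= k < N.+1) dot (r k) (r k)) <=
    16 * (G * P3) + 8 * (delta * sq1) + 8 * (delta * (delta * sq2))
    + 8 * P1 + 4 * P2.
  lra.
move=> /(ler_wpM2l Gi0); lra.
Qed.
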